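(* Let $A$ be a regular ring containing a field of characteristic zero, let $m\ge 1$, and let $R=A[X_1,\ldots,X_m]$ be graded by $\deg A=0$ and $\deg X_i=1$ for all $i$. Let $I$ be a homogeneous ideal of $R$, let $i\ge 0$, and let $M=H^i_I(R)=\bigoplus_{n\in\mathbb{Z}}M_n$. Then: (a) The following are equivalent: (i) $M_r\neq 0$ for some $r\le -m$; (ii) $M_n\neq 0$ for all $n\le -m$. (b) The following are equivalent: (i) $M_s\neq 0$ for some $s\ge 0$; (ii) $M_n\neq 0$ for all $n\ge 0$. (c) If $m\ge 2$, the following are equivalent: (i) $M_t\ne 0$ for some $t$ with $-m<t<0$; (ii) $M_n\neq 0$ for all $n\in\mathbb{Z}$.
   Context: Regular rings are commutative and Noetherian. $H^i_I(R)$ denotes the $i$-th local cohomology module of $R$ with support in $I$; it is a graded $R$-module, and $M_n$ is its degree $n$ component, which is an $A$-module. *)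

(* Defs.v *)
From HB Require Import structures.
From mathcomp Require Import all_boot all_order all_algebra.
From mathcomp Require Import mpoly.
Set Implicit Arguments.
Unset Strict Implicit.
Unset Printing Implicit Defensive.
Import Order.TTheory GRing.Theory Num.Theory.
Local Open Scope ring_scope.

(* Ideals are Prop-valued: the library's [idealr_closed] only covers decidable
   proper ideals, and here the unit ideal must be allowed. *)
Record is_ideal (R : comNzRingType) (J : R -> Prop) : Prop := IsIdeal {
  ideal0 : J 0;
  idealD : forall x y, J x -> J y -> J (x + y);
  idealM : forall a x, J x -> J (a * x) }.

Record is_prime_ideal (R : comNzRingType) (P : R -> Prop) : Prop :=
  IsPrimeIdeal {
    prime_is_ideal : is_ideal P;
    prime_proper : ~ P 1;
    prime_mul : forall x y, P (x * y) -> P x \/ P y }.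

Definition ideal_span (R : comNzRingType) (S : R -> Prop) (x : R) : Prop :=
  exists s : seq (R * R),
    (forall c, c \in s -> S c.2) /\ x = \sum_(c <- s) c.1 * c.2.

Definition ideal_pow (R : comNzRingType) (J : R -> Prop) (k : nat) : R -> Prop :=
  ideal_span (fun x => exists t : k.-tuple R,
    (forall y, y \in t -> J y) /\ x = \prod_(y <- t) y).

Definition noetherian (R : comNzRingType) : Prop :=
  forall J : R -> Prop, is_ideal J ->
    exists s : seq R, forall x, J x <-> ideal_span (fun y => y \in s) x.

Definition is_unit (R : comNzRingType) (x : R) : Prop := exists y, x * y = 1.

Definition is_local_ring (R : comNzRingType) : Prop :=
  is_ideal (fun x : R => ~ is_unit x).

Definition has_prime_chain (R : comNzRingType) (h : nat) : Prop :=
  exists P : nat -> R -> Prop,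
    (forall j, (j <= h)%N -> is_prime_ideal (P j)) /\
    (forall j, (j < h)%N ->
       (forall x, P j x -> P j.+1 x) /\ (exists x, P j.+1 x /\ ~ P j x)).

Definition krull_dim (R : comNzRingType) (h : nat) : Prop :=
  has_prime_chain R h /\ ~ has_prime_chain R h.+1.

Definition regular_local_ring (R : comNzRingType) : Prop :=
  [/\ noetherian R, is_local_ring R &
      exists h, krull_dim R h /\
        exists t : h.-tuple R,
          forall x, ~ is_unit x <-> ideal_span (fun y => y \in t) x].

Record is_localization_at (R : comNzRingType) (P : R -> Prop)
    (L : comNzRingType) (f : {rmorphism R -> L}) : Prop := IsLocalizationAt {
  loc_unit : forall s, ~ P s -> is_unit (f s);
  loc_surj : forall y, exists a s, ~ P s /\ f s * y = f a;
  loc_ker : forall a, f a = 0 -> exists s, ~ P s /\ s * a = 0 }.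

Definition regular_ring (R : comNzRingType) : Prop :=
  noetherian R /\
  forall P : R -> Prop, is_prime_ideal P ->
    forall (L : comNzRingType) (f : {rmorphism R -> L}),
      is_localization_at P f -> regular_local_ring L.

(* A ring morphism from a field to a nonzero ring is injective. *)
Definition contains_field_char0 (R : comNzRingType) : Prop :=
  exists k : fieldType, [pchar k] =i pred0 /\ inhabited {rmorphism k -> R}.

Record is_homogeneous_ideal (A : comNzRingType) (m : nat)
    (I : {mpoly A[m]} -> Prop) : Prop := IsHomogeneousIdeal {
  hideal_ideal : is_ideal I;
  hideal_comp : forall p d, I p -> I (pihomog mdeg d p) }.

(* [G n] is the degree-[n] piece of the Z-graded module [M]. *)
Record is_grading (A : comNzRingType) (m : nat) (M : lmodType {mpoly A[m]})
    (G : int -> M -> Prop) : Prop := IsGrading {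
  grading0 : forall n, G n 0;
  gradingB : forall n x y, G n x -> G n y -> G n (x - y);
  gradingZ : forall d n (r : {mpoly A[m]}) x,
    r \is d.-homog -> G n x -> G (d%:Z + n) (r *: x);
  grading_span : forall x, exists (s : seq int) (u : int -> M),
    [/\ uniq s, forall n, G n (u n) & x = \sum_(n <- s) u n];
  grading_direct : forall (s : seq int) (u : int -> M),
    uniq s -> (forall n, G n (u n)) -> \sum_(n <- s) u n = 0 ->
    forall n, n \in s -> u n = 0 }.

Record gradedModule (A : comNzRingType) (m : nat) := GradedModule {
  gm_sort :> lmodType {mpoly A[m]};
  gm_deg : int -> gm_sort -> Prop;
  gm_gradingP : is_grading gm_deg }.

Definition component_neq0 (A : comNzRingType) (m : nat)
    (M : gradedModule A m) (n : int) : Prop :=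
  exists x : M, gm_deg n x /\ x <> 0.

Definition mpoly_deg (A : comNzRingType) (m : nat) (n : int)
    (p : {mpoly A[m]}^o) : Prop :=
  match n with
  | Posz d => (p : {mpoly A[m]}) \is d.-homog
  | Negz _ => p = 0
  end.

Lemma mpoly_grading (A : comNzRingType) (m : nat) :
  is_grading (@mpoly_deg A m).
Proof.
split.
- by case=> [d|d] //=; apply: dhomog0.
- case=> [d|d] x y /=; last by move=> -> ->; rewrite subr0.
  by move=> hx hy; apply: rpredB.
- move=> d [e|e] r x hr /= hx; first exact: dhomogM.
  rewrite hx scaler0; case: (_ + _) => //= k; exact: dhomog0.
- move=> x.
  exists [seq Posz d | d <- iota 0 (msize (x : {mpoly A[m]}))].
  exists (fun n : int =>
    match n with Posz d => pihomog mdeg d (x : {mpoly A[m]}) | _ => 0 end).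
  split.
  + by rewrite map_inj_uniq ?iota_uniq // => a b [].
  + by case=> //= d; apply: pihomogP.
  + rewrite big_map /=.
    have -> : iota 0 (msize (x : {mpoly A[m]})) =
              index_iota 0 (msize (x : {mpoly A[m]})).
      by rewrite /index_iota subn0.
    rewrite big_mkord.
    exact: (@pihomog_partitionE _ _ mdeg _ _ (leqnn _)).
- move=> s u us hu hs [d|d] hd; last exact: (hu (Negz d)).
  have h : pihomog mdeg d (\sum_(n <- s) (u n : {mpoly A[m]})) = 0.
    by rewrite hs linear0.
  rewrite linear_sum /= (bigD1_seq (Posz d)) //= big1 ?addr0 in h.
    by move: h; rewrite pihomog_dE //; exact: (hu (Posz d)).
  move=> [e|e] ne; last by rewrite (hu (Negz e)) linear0.
  rewrite (pihomog_ne0 _ (hu (Posz e))) //.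
Qed.

Definition mpoly_graded (A : comNzRingType) (m : nat) : gradedModule A m :=
  GradedModule (mpoly_grading A m).

Definition graded_hom (A : comNzRingType) (m : nat) (M N : gradedModule A m)
    (f : {linear M -> N}) : Prop :=
  forall n x, gm_deg n x -> gm_deg n (f x).

(* Injectivity in the category of graded modules and degree-0 morphisms. *)
Definition graded_injective (A : comNzRingType) (m : nat)
    (E : gradedModule A m) : Prop :=
  forall (N N' : gradedModule A m) (j : {linear N -> N'}) (f : {linear N -> E}),
    graded_hom j -> injective j -> graded_hom f ->
    exists g : {linear N' -> E}, graded_hom g /\ forall x, g (j x) = f x.

Record injective_resolution (A : comNzRingType) (m : nat)
    (N : gradedModule A m) := InjectiveResolution {
  ir_obj : nat -> gradedModule A m;
  ir_aug : {linear N -> ir_obj 0};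
  ir_diff : forall k, {linear ir_obj k -> ir_obj k.+1};
  ir_aug_hom : graded_hom ir_aug;
  ir_diff_hom : forall k, graded_hom (ir_diff k);
  ir_injective : forall k, graded_injective (ir_obj k);
  ir_aug_inj : injective ir_aug;
  ir_exact0 : forall x, ir_diff 0 x = 0 <-> exists y, x = ir_aug y;
  ir_exactS : forall k x, ir_diff k.+1 x = 0 <-> exists y, x = ir_diff k y }.

Definition Gamma (A : comNzRingType) (m : nat) (I : {mpoly A[m]} -> Prop)
    (N : gradedModule A m) (x : N) : Prop :=
  exists k : nat, forall r, ideal_pow I k r -> r *: x = 0.

Section GammaComplex.
Context (A : comNzRingType) (m : nat) (I : {mpoly A[m]} -> Prop).
Context (N : gradedModule A m) (E : injective_resolution N).

Definition Gamma_cocycle (i : nat) (x : ir_obj E i) : Prop :=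
  Gamma I x /\ ir_diff E i x = 0.

Definition Gamma_coboundary (i : nat) : ir_obj E i -> Prop :=
  match i with
  | 0%N => fun x => x = 0
  | j.+1 => fun x => exists y : ir_obj E j, Gamma I y /\ x = ir_diff E j y
  end.

End GammaComplex.

(* [M] is, up to isomorphism of graded modules, the [i]-th right derived functor
   of the I-torsion functor [Gamma I] at [N]: [q] presents [M] as the quotient
   cocycles / coboundaries of [Gamma I E], with the induced grading.  The values
   of [q] outside the cocycles are irrelevant. *)
Definition is_local_cohomology (A : comNzRingType) (m : nat)
    (I : {mpoly A[m]} -> Prop) (i : nat) (N M : gradedModule A m) : Prop :=
  exists (E : injective_resolution N) (q : ir_obj E i -> M),
    [/\ forall (r : {mpoly A[m]}) x y,
          Gamma_cocycle I x -> Gamma_cocycle I y ->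
          q (r *: x + y) = r *: q x + q y,
        forall z, exists x, Gamma_cocycle I x /\ q x = z,
        forall x, Gamma_cocycle I x -> (q x = 0 <-> Gamma_coboundary I x) &
        forall n x, Gamma_cocycle I x -> gm_deg n x -> gm_deg n (q x)].

(* Main.v *)
Require Import Defs.
From HB Require Import structures.
From mathcomp Require Import all_boot all_order all_algebra.
From mathcomp Require Import mpoly.
From mathcomp Require Import boolp zify.
Set Implicit Arguments.
Unset Strict Implicit.
Unset Printing Implicit Defensive.
Import Order.TTheory GRing.Theory Num.Theory.
Local Open Scope ring_scope.

(** The theorem is a formal consequence of the action of the Weyl algebra on
    [M]: there are additive operators [D_j] of degree -1 on [M] satisfying the
    Leibniz rule over the partial derivatives of [R = A[X_1, ..., X_m]], and the
    Euler operator [\sum_j X_j D_j] is multiplication by [n] on [M_n].  Since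
    [D_j X_j = X_j D_j + 1], the operator [\sum_j D_j X_j] is then
    multiplication by [n + m] on [M_n].  Nonzero integers are invertible in [A],
    so a nonzero [z] in [M_n] has some [D_j z <> 0] unless [n = 0], and some
    [X_j z <> 0] unless [n = - m].  Nonvanishing therefore spreads from any
    degree to its neighbours, except downwards from 0 and upwards from [- m],
    and the three equivalences are what this leaves.

    The operators are built directly on a graded injective resolution [E] of
    [R], with no recourse to the Cech complex.

    - On a single graded injective module, [injective_derivation] finds a
      derivation over the [j]-th partial derivative: such a derivation is a
      linear section of an extension of [E] by [E] whose scalar multiplication
      is twisted by that derivative, and injectivity splits the extension.

    - Two derivations over the same partial derivative differ by a linear map,
      so the usual inductive construction of chain maps into injective
      resolutions corrects the chosen derivations until they commute with the
      differentials ([derivation_along]).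

    - The Euler operator minus the degree operator is linear, of degree 0, and
      lifts the zero map of [R] by Euler's identity for homogeneous polynomials.
      Hence it is null-homotopic, and since a linear homotopy preserves
      I-torsion it vanishes on local cohomology ([euler_homotopic_exists],
      [local_cohomology_euler]).

    A derivation maps the elements killed by [I^k] to elements killed by
    [I^(k+1)], so it acts on the complex of I-torsion submodules.  The
    homogeneity of [I] makes the homogeneous components of a torsion cocycle
    torsion cocycles, so that homogeneous classes have homogeneous
    representatives. *)

(** * Components and the degree operator of a graded module *)

Section Grading.
Context (A : comNzRingType) (m : nat).
Implicit Types M N : gradedModule A m.

Definition has_degree M N (e : int) (f : M -> N) : Prop :=
  forall n x, gm_deg n x -> gm_deg (n + e) (f x).

Lemma graded_hom_degree M N (f : {linear M -> N}) :
  graded_hom f -> has_degree 0 f.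
Proof. by move=> hf n x hx; rewrite addr0; exact: hf. Qed.

Lemma gm_deg0 M n : gm_deg n (0 : M).
Proof. exact: grading0 (gm_gradingP M) n. Qed.

Lemma gm_degB M n (x y : M) : gm_deg n x -> gm_deg n y -> gm_deg n (x - y).
Proof. exact: (gradingB (gm_gradingP M)). Qed.

Lemma gm_degN M n (x : M) : gm_deg n x -> gm_deg n (- x).
Proof. by move=> hx; rewrite -sub0r; apply/gm_degB/hx/gm_deg0. Qed.

Lemma gm_degD M n (x y : M) : gm_deg n x -> gm_deg n y -> gm_deg n (x + y).
Proof. by move=> hx hy; rewrite -[y]opprK; apply/gm_degB/gm_degN. Qed.

Lemma gm_degZ M d n (r : {mpoly A[m]}) (x : M) :
  r \is d.-homog -> gm_deg n x -> gm_deg (n + d%:Z) (r *: x).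
Proof.
by move=> hr hx; rewrite addrC; exact: gradingZ (gm_gradingP M) _ _ _ _ hr hx.
Qed.

Lemma gm_deg_sum M n (J : Type) (s : seq J) (F : J -> M) :
  (forall j, gm_deg n (F j)) -> gm_deg n (\sum_(j <- s) F j).
Proof.
move=> hF; elim/big_ind: _ => // [|x y]; [exact: gm_deg0 | exact: gm_degD].
Qed.

Lemma gm_degMz M n (x : M) k : gm_deg n x -> gm_deg n (x *~ k).
Proof.
move=> hx; case: k => k; rewrite -?pmulrn ?NegzE ?mulrNz; last apply/gm_degN.
  by elim: k => [|k ih]; rewrite ?mulr0n ?mulrS; [exact: gm_deg0 | exact: gm_degD].
by elim: k => [|k ih]; rewrite ?mulr1z // -pmulrn mulrS; apply: gm_degD.
Qed.

Lemma graded_ind M (P : M -> Prop) :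
  P 0 -> (forall x y, P x -> P y -> P (x + y)) ->
  (forall n x, gm_deg n x -> P x) -> forall x, P x.
Proof.
move=> P0 PD Phom x; have [s [u [_ hu ->]]] := grading_span (gm_gradingP M) x.
by elim/big_ind: _ => // n _; apply: Phom (hu n).
Qed.

Definition decomposes M (x : M) (c : seq int * (int -> M)) : Prop :=
  [/\ uniq c.1, forall n, gm_deg n (c.2 n), forall n, n \notin c.1 -> c.2 n = 0
    & x = \sum_(n <- c.1) c.2 n].

Lemma decomposition_exists M (x : M) : exists c, decomposes x c.
Proof.
have [s [u [us hu ->]]] := grading_span (gm_gradingP M) x.
exists (s, fun n => if n \in s then u n else 0); split=> //= [n|n /negPf->//|].
  by case: ifP => // _; exact: gm_deg0.
by rewrite !big_seq; apply: eq_bigr => n ->.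
Qed.

Definition degrees M (x : M) : seq int :=
  (sval (cid (decomposition_exists x))).1.

Definition component M (n : int) (x : M) : M :=
  (sval (cid (decomposition_exists x))).2 n.

Lemma componentP M (x : M) :
  [/\ uniq (degrees x), forall n, gm_deg n (component n x),
      forall n, n \notin degrees x -> component n x = 0
    & x = \sum_(n <- degrees x) component n x].
Proof. by rewrite /degrees /component; case: cid. Qed.

Lemma component_deg M n (x : M) : gm_deg n (component n x).
Proof. by case: (componentP x). Qed.

Lemma sum_subset (V : zmodType) (s t : seq int) (u : int -> V) :
  uniq s -> uniq t -> {subset s <= t} -> (forall n, n \notin s -> u n = 0) ->
  \sum_(n <- s) u n = \sum_(n <- t) u n.
Proof.
move=> us ut st u0; rewrite [RHS](bigID (mem s)) /= [X in _ + X]big1 // addr0.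
rewrite -[RHS]big_filter; apply: perm_big; apply: uniq_perm; rewrite ?filter_uniq //.
by move=> n; rewrite mem_filter; case hn: (n \in s) => //=; rewrite st.
Qed.

(** Any two decompositions can be compared over the union of their supports,
    where directness of the grading applies to the difference. *)
Lemma component_uniq M (x : M) (s : seq int) (u : int -> M) :
  uniq s -> (forall n, gm_deg n (u n)) -> x = \sum_(n <- s) u n ->
  forall n, component n x = if n \in s then u n else 0.
Proof.
move=> us hu xE; have [ud hd d0 xE'] := componentP x.
pose v n := if n \in s then u n else 0.
have v0 n : n \notin s -> v n = 0 by rewrite /v => /negPf->.
pose t := undup (degrees x ++ s).
have ut : uniq t by exact: undup_uniq.
have dt : {subset degrees x <= t} by move=> k hk; rewrite mem_undup mem_cat hk.
have st : {subset s <= t} by move=> k hk; rewrite mem_undup mem_cat hk orbT.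
have hv : x = \sum_(n <- s) v n.
  by rewrite xE !big_seq; apply: eq_bigr => n hn; rewrite /v hn.
have h0 : \sum_(n <- t) (component n x - v n) = 0.
  rewrite sumrB -(sum_subset ud ut dt d0) -(sum_subset us ut st v0).
  by rewrite -xE' -hv subrr.
have hw n : gm_deg n (component n x - v n).
  by apply: gm_degB => //; rewrite /v; case: ifP => // _; exact: gm_deg0.
move=> n; have [nt|nt] := boolP (n \in t).
  apply/eqP; rewrite -subr_eq0; apply/eqP.
  exact: (grading_direct (gm_gradingP M) ut hw h0).
rewrite d0; last by apply: contra nt => /dt.
by rewrite ifN //; apply: contra nt => /st.
Qed.

Lemma component_homog_at M k n (x : M) :
  gm_deg n x -> component k x = if k == n then x else 0.
Proof.
move=> hx.
rewrite (@component_uniq M x [:: n] (fun k => if k == n then x else 0)) //.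
- by rewrite inE; case: (k == n).
- by move=> l; case: eqP => [->//|_]; exact: gm_deg0.
by rewrite big_seq1 eqxx.
Qed.

Lemma component_homog M n (x : M) : gm_deg n x -> component n x = x.
Proof. by move/component_homog_at->; rewrite eqxx. Qed.

Lemma component_map M N (e : int) (f : {additive M -> N}) :
  has_degree e f -> forall n x, component (n + e) (f x) = f (component n x).
Proof.
move=> hf n x; have [ud hd d0 xE] := componentP x.
rewrite (@component_uniq N (f x) [seq k + e | k <- degrees x]
           (fun k => f (component (k - e) x))).
- have -> : (n + e \in [seq k + e | k <- degrees x]) = (n \in degrees x).
    exact: (mem_map (addIr e)).
  by rewrite addrK; case: ifPn => // /d0 ->; rewrite raddf0.
- by rewrite map_inj_uniq //; exact: addIr.
- by move=> k; rewrite -[k in gm_deg k](subrK e); apply: hf.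
by rewrite big_map {1}xE raddf_sum; apply: eq_bigr => k _; rewrite addrK.
Qed.

Lemma componentD M n (x y : M) :
  component n (x + y) = component n x + component n y.
Proof.
have [ux hx x0 xE] := componentP x; have [uy hy y0 yE] := componentP y.
pose t := undup (degrees x ++ degrees y).
have ut : uniq t by exact: undup_uniq.
have xt : {subset degrees x <= t} by move=> k hk; rewrite mem_undup mem_cat hk.
have yt : {subset degrees y <= t}.
  by move=> k hk; rewrite mem_undup mem_cat hk orbT.
rewrite (@component_uniq M _ t (fun k => component k x + component k y)) //.
- case: ifPn => //; rewrite mem_undup mem_cat negb_or => /andP[hnx hny].
  by rewrite x0 // y0 // addr0.
- by move=> k; apply: gm_degD.
by rewrite big_split -(sum_subset ux ut xt x0) -(sum_subset uy ut yt y0) -xE -yE.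
Qed.

Definition degree_op M (x : M) : M := \sum_(n <- degrees x) component n x *~ n.

Lemma degree_op_widen M (x : M) t : uniq t -> {subset degrees x <= t} ->
  degree_op x = \sum_(n <- t) component n x *~ n.
Proof.
have [ux hx x0 xE] := componentP x => ut xt.
by apply: sum_subset => // n /x0 ->; rewrite mul0rz.
Qed.

Lemma degree_opD M : {morph @degree_op M : x y / x + y}.
Proof.
move=> x y; pose t := undup (degrees x ++ degrees y ++ degrees (x + y)).
have ut : uniq t by exact: undup_uniq.
rewrite !(@degree_op_widen _ _ t) //.
  by rewrite -big_split; apply: eq_bigr => n _; rewrite componentD mulrzDl.
all: by move=> k hk; rewrite mem_undup !mem_cat hk ?orbT.
Qed.

Lemma degree_op_homog M n (x : M) : gm_deg n x -> degree_op x = x *~ n.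
Proof.
move=> hx; pose t := undup (n :: degrees x).
have ut : uniq t by exact: undup_uniq.
have nt : n \in t by rewrite mem_undup inE eqxx.
rewrite (@degree_op_widen _ _ t) //; last first.
  by move=> k hk; rewrite mem_undup inE hk orbT.
rewrite (bigD1_seq n) //= component_homog // big1 ?addr0 // => k kn.
by rewrite (component_homog_at k hx) (negPf kn) mul0rz.
Qed.

Lemma degree_op0 M : degree_op (0 : M) = 0.
Proof. by rewrite (@degree_op_homog _ 0) ?mulr0z //; exact: gm_deg0. Qed.

Lemma degree_op_map M N (f : {additive M -> N}) :
  has_degree 0 f -> forall x, degree_op (f x) = f (degree_op x).
Proof.
move=> hf; elim/graded_ind => [|x y hx hy|n x hx].
- by rewrite raddf0 !degree_op0 raddf0.
- by rewrite raddfD !degree_opD hx hy raddfD.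
rewrite !(@degree_op_homog _ n) // ?raddfMz //.
by rewrite -[n]addr0; apply: hf.
Qed.

End Grading.

(** * Extension of linear maps into a graded injective module *)

Definition to_linear (R : nzRingType) (U V : lmodType R) (f : U -> V)
    (f_lin : linear f) : {linear U -> V} :=
  HB.pack f (GRing.isLinear.Build R U V _ f f_lin).

Section Shift.
Context (A : comNzRingType) (m : nat) (e : int) (M : gradedModule A m).

Lemma shift_grading : is_grading (fun n (x : M) => gm_deg (n + e) x).
Proof.
split=> [n|n x y|d n r x hr hx|x|s u us hu s0 n ns].
- exact: gm_deg0.
- exact: gm_degB.
- by rewrite -addrA; exact: gradingZ (gm_gradingP M) _ _ _ _ hr hx.
- have [s [u [us hu ->]]] := grading_span (gm_gradingP M) x.
  exists [seq k - e | k <- s], (fun k => u (k + e)); split=> //.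
    by rewrite map_inj_uniq //; exact: addIr.
  by rewrite big_map; apply: eq_bigr => k _; rewrite subrK.
have := @grading_direct _ _ _ _ (gm_gradingP M) [seq k + e | k <- s]
  (fun k => u (k - e)).
move=> /(_ _ _ _ (n + e)); rewrite addrK; apply.
- by rewrite map_inj_uniq //; exact: addIr.
- by move=> k; rewrite -[k in gm_deg k](subrK e).
- by rewrite -[RHS]s0 big_map; apply: eq_bigr => k _; rewrite addrK.
by rewrite (mem_map (addIr e)).
Qed.

Definition shift : gradedModule A m := GradedModule shift_grading.

End Shift.

Section Image.
Context (R : nzRingType) (U V : lmodType R) (f : {linear U -> V}).

Definition in_image : {pred V} := fun y => `[< exists x, y = f x >].

Lemma in_imageP y : reflect (exists x, y = f x) (y \in in_image).
Proof. exact: asboolP. Qed.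

Lemma in_image_submod_closed : submod_closed in_image.
Proof.
split; first by apply/in_imageP; exists 0; rewrite linear0.
move=> a _ _ /in_imageP[x ->] /in_imageP[y ->]; apply/in_imageP.
by exists (a *: x + y); rewrite linearP.
Qed.

HB.instance Definition _ :=
  GRing.isSubmodClosed.Build R V in_image in_image_submod_closed.

Record image_of : Type := ImageOf {
  image_val :> V;
  image_valP : image_val \in in_image }.

HB.instance Definition _ := [isSub for image_val].
HB.instance Definition _ := [Choice of image_of by <:].
HB.instance Definition _ := [SubChoice_isSubZmodule of image_of by <:].
HB.instance Definition _ := [SubZmodule_isSubLmodule of image_of by <:].

Lemma image_of_exists (y : image_of) : exists x, val y = f x.
Proof. exact/in_imageP/image_valP. Qed.

Definition to_image (x : U) : image_of :=
  ImageOf (introT (in_imageP _) (ex_intro _ x erefl)).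

Definition preimage (y : image_of) : U := sval (cid (image_of_exists y)).

Lemma preimageK (y : image_of) : f (preimage y) = val y.
Proof. by rewrite /preimage; case: cid. Qed.

End Image.

Section Extension.
Context (A : comNzRingType) (m : nat).
Implicit Types M N E : gradedModule A m.

Lemma image_grading M N (d : {linear M -> N}) : graded_hom d ->
  is_grading (fun n (y : image_of d) => gm_deg n (val y : N)).
Proof.
move=> hd; split=> [n|n x y|k n r x hr hx|y|s u us hu s0 n ns].
- by rewrite linear0; exact: gm_deg0.
- by rewrite linearB; exact: gm_degB.
- by rewrite linearZ; exact: gradingZ (gm_gradingP N) _ _ _ _ hr hx.
- have [x yx] := image_of_exists y.
  have [s [u [us hu xE]]] := grading_span (gm_gradingP M) x.
  exists s, (fun n => to_image d (u n)); split=> // [n|]; first exact: hd.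
  by apply: val_inj; rewrite yx xE !linear_sum.
apply: val_inj; rewrite linear0.
apply: (grading_direct (gm_gradingP N) (u := fun n => val (u n)) us) => //.
by rewrite -linear_sum s0 linear0.
Qed.

Definition image_graded M N (d : {linear M -> N}) (hd : graded_hom d) :=
  GradedModule (image_grading hd).

(** The form in which injectivity is used throughout.  The map [phi] factors
    through the image of [d], a graded submodule of [N], and shifting both the
    image and [N] turns a map of degree [e] into one of degree 0. *)
Lemma extend_along M N E (d : {linear M -> N}) (e : int) (phi : M -> E) :
  graded_injective E -> graded_hom d -> linear phi -> has_degree e phi ->
  (forall x, d x = 0 -> phi x = 0) ->
  exists h : {linear N -> E}, has_degree e h /\ forall x, h (d x) = phi x.
Proof.
move=> Einj hd phi_lin phi_deg phi0.
pose Phi := to_linear phi_lin.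
have phi_eq x y : d x = d y -> phi x = phi y.
  move=> dxy; apply/eqP; rewrite -subr_eq0 -(linearB Phi).
  by apply/eqP/phi0; rewrite linearB dxy subrr.
pose J := shift (- e) (image_graded hd); pose N' := shift (- e) N.
pose j : J -> N' := val; pose f (y : J) : E := phi (preimage y).
have j_lin : linear j by move=> a x y; rewrite /j linearP.
have f_lin : linear f.
  move=> a x y; rewrite -(linearP Phi); apply: phi_eq.
  by rewrite linearP !preimageK linearP.
have [h [h_deg hE]] : exists h : {linear N' -> E}, graded_hom h /\
    forall x : J, h (to_linear j_lin x) = to_linear f_lin x.
  apply: Einj => [n x //| |n x /= hx]; first exact: val_inj.
  (* The chosen preimage need not be homogeneous, but its component of the
     right degree is also a preimage. *)
  have hx' : gm_deg (n - e) (d (preimage x)) by rewrite preimageK.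
  rewrite /f -(@phi_eq (component (n - e) (preimage x))).
    by rewrite -[n in gm_deg n](subrK e); exact/phi_deg/component_deg.
  rewrite -(component_map (e := 0)); last first.
    by move=> k z hz; rewrite addr0; exact: (@hd k z hz).
  by rewrite addr0 component_homog.
exists h; split=> [n x hx|x]; first by apply: h_deg => /=; rewrite addrK.
rewrite -[d x]/(to_linear j_lin (to_image d x)) hE /=; apply: phi_eq.
by rewrite preimageK.
Qed.

End Extension.

(** * Partial derivatives of homogeneous polynomials *)

Section Polynomials.
Context (A : comNzRingType) (m : nat).
Local Notation R := {mpoly A[m]}.

Lemma mderiv_homog (j : 'I_m) d (r : R) :
  r \is d.+1.-homog -> r^`M(j) \is d.-homog.
Proof.
move=> hr; rewrite [r]mpolyE raddf_sum big_seq; apply: rpred_sum => k km.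
rewrite /= mderivZ mderivX; apply/rpredZ.
have [->|kj] := eqVneq (k j) 0%N; first by rewrite scale0r rpred0.
apply/rpredZ; rewrite dhomogX /= -eqSS -[in X in X == _]addn1 -(mdeg1 j) -mdegD.
by rewrite submK ?lep1mP // (dhomogP _ _ _ hr _ km).
Qed.

Lemma mderiv_homog0 (j : 'I_m) (r : R) : r \is 0.-homog -> r^`M(j) = 0.
Proof.
move=> hr; rewrite [r]mpolyE raddf_sum big_seq big1 // => k km.
rewrite /= mderivZ mderivX (_ : k = 0%MM) ?mnm0E ?scale0r ?scaler0 //.
by apply/eqP; rewrite -mdeg_eq0; apply/eqP/(dhomogP _ _ _ hr).
Qed.

(** Euler's identity: on a monomial, [X_j d/dX_j] is multiplication by the
    exponent of [X_j]. *)
Lemma mpoly_euler d (r : R) : r \is d.-homog ->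
  \sum_(j < m) 'X_j * r^`M(j) = r *+ d.
Proof.
move=> hr; rewrite [r]mpolyE -sumrMnl.
under eq_bigr do rewrite raddf_sum mulr_sumr.
rewrite exchange_big /= !big_seq; apply: eq_bigr => k km.
rewrite -(dhomogP _ _ _ hr _ km) /= mdegE -sumrMnr; apply: eq_bigr => j _.
rewrite mderivZ mderivX -scalerAr -scalerAr -scaler_nat.
have [->|kj] := eqVneq (k j) 0%N; first by rewrite !scale0r scaler0.
by rewrite -mpolyXD addmC submK ?lep1mP // scalerA mulrC -scalerA.
Qed.

Lemma mpolyX_homog (j : 'I_m) : ('X_j : R) \is 1.-homog.
Proof. by rewrite dhomogX /= mdeg1. Qed.

Lemma mderiv_X (j : 'I_m) : ('X_j : R)^`M(j) = 1.
Proof.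
rewrite mderivX mnm1E eqxx (_ : (U_(j) - U_(j))%MM = 0%MM).
  by rewrite mpolyX0 scale1r.
by apply/mnmP => k; rewrite mnmBE subnn mnm0E.
Qed.

End Polynomials.

(** * Derivations of graded modules over the partial derivatives *)

Section Derivation.
Context (A : comNzRingType) (m : nat).
Local Notation R := {mpoly A[m]}.
Implicit Types M N E : gradedModule A m.

Record derivation_over (j : 'I_m) M (delta : M -> M) : Prop := DerivationOver {
  derivationD : {morph delta : x y / x + y};
  derivationZ : forall (r : R) x, delta (r *: x) = r *: delta x + r^`M(j) *: x;
  derivation_deg : has_degree (-1) delta }.

Lemma derivation0 (j : 'I_m) M (delta : M -> M) :
  derivation_over j delta -> delta 0 = 0.
Proof.
by move=> [deltaD _ _]; apply: (addIr (delta 0)); rewrite -deltaD !add0r.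
Qed.

(** The scalar multiplication on [twist j E] is chosen so that [delta] is a
    derivation over the [j]-th partial derivative exactly when the map
    [x |-> (x, delta x)] is linear. *)
Definition twist (j : 'I_m) (E : lmodType R) : Type := (E * E)%type.

Section Twist.
Context (j : 'I_m) (E : lmodType R).

HB.instance Definition _ := GRing.Zmodule.on (twist j E).

Definition twist_scale (r : R) (x : twist j E) : twist j E :=
  (r *: x.1, r *: x.2 + r^`M(j) *: x.1).

Lemma twist_scaleA a b v :
  twist_scale a (twist_scale b v) = twist_scale (a * b) v.
Proof.
congr pair; rewrite /= ?scalerA // mderivM scalerDr scalerDl !scalerA.
by rewrite -addrA [_ *: _ + (a^`M(j) * b) *: _]addrC.
Qed.

Lemma twist_scale1 : left_id 1 twist_scale.
Proof.
by case=> a b; rewrite /twist_scale !scale1r -mpolyC1 mderivC scale0r addr0.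
Qed.

Lemma twist_scaleDr : right_distributive twist_scale +%R.
Proof. by move=> r x y; congr pair; rewrite /= !scalerDr // addrACA. Qed.

Lemma twist_scaleDl v : {morph twist_scale^~ v : a b / a + b}.
Proof.
by move=> a b; congr pair; rewrite /= ?mderivD !scalerDl // addrACA.
Qed.

HB.instance Definition _ := GRing.Zmodule_isLmodule.Build R (twist j E)
  twist_scaleA twist_scale1 twist_scaleDr twist_scaleDl.

End Twist.

(** The first factor is shifted by one because the derivations sought have
    degree -1. *)
Lemma twist_grading (j : 'I_m) E : is_grading
  (fun n (x : twist j E) => gm_deg (n + 1) (x.1 : E) /\ gm_deg n (x.2 : E)).
Proof.
have sum1 (s : seq int) (u : int -> twist j E) :
    (\sum_(n <- s) u n).1 = \sum_(n <- s) (u n).1.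
  by elim/big_rec2: _ => // n y1 y2 _ <-.
have sum2 (s : seq int) (u : int -> twist j E) :
    (\sum_(n <- s) u n).2 = \sum_(n <- s) (u n).2.
  by elim/big_rec2: _ => // n y1 y2 _ <-.
split.
- by move=> n; split; exact: gm_deg0.
- by move=> n x y [hx1 hx2] [hy1 hy2]; split; exact: gm_degB.
- move=> d n r x hr [hx1 hx2]; split => /=.
    by rewrite -addrA addrC; exact: gm_degZ.
  apply: gm_degD; first by rewrite addrC; exact: gm_degZ.
  case: d hr => [|d] hr.
    by rewrite mderiv_homog0 // scale0r; exact: gm_deg0.
  rewrite -addn1 PoszD -addrA [1 + n]addrC addrC; apply: gm_degZ => //.
  exact: mderiv_homog.
- move=> x; have [u1 h1 z1 x1E] := componentP (x.1 : E).
  have [u2 h2 z2 x2E] := componentP (x.2 : E).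
  pose t := undup ([seq n - 1 | n <- degrees (x.1 : E)] ++ degrees (x.2 : E)).
  have ut : uniq t by exact: undup_uniq.
  exists t, (fun n => (component (n + 1) (x.1 : E), component n (x.2 : E))).
  split; [exact: ut|by split; exact: component_deg|].
  apply: injective_projections; rewrite ?sum1 ?sum2 /=; last first.
    rewrite {1}x2E; apply: sum_subset => // n hn.
    by rewrite mem_undup mem_cat hn orbT.
  transitivity (\sum_(n <- [seq n - 1 | n <- degrees (x.1 : E)])
                  component (n + 1) (x.1 : E)).
    by rewrite big_map {1}x1E; apply: eq_bigr => n _; rewrite subrK.
  apply: sum_subset => // [|n hn|n hn].
  + by rewrite map_inj_uniq //; exact: addIr.
  + by rewrite mem_undup mem_cat hn.
  apply: z1; apply: contra hn => hn; apply/mapP; exists (n + 1) => //.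
  by rewrite addrK.
move=> s u us hu s0 n ns; apply: injective_projections.
  apply: (grading_direct (gm_gradingP (shift 1 E)) (u := fun n => (u n).1) us).
  - by move=> k; case: (hu k).
  - by rewrite -sum1 s0.
  by [].
apply: (grading_direct (gm_gradingP E) (u := fun n => (u n).2) us) => //.
  by move=> k; case: (hu k).
by rewrite -sum2 s0.
Qed.

Definition twist_graded (j : 'I_m) E : gradedModule A m :=
  GradedModule (twist_grading j E).

(** Injectivity gives a retraction [g] of [y |-> (0, y)].  The kernel of [g] is
    a linear complement that maps isomorphically onto the first factor, hence
    the graph of a derivation, namely of [x |-> - g (x, 0)]. *)
Lemma injective_derivation E (j : 'I_m) : graded_injective E ->
  exists delta : E -> E, derivation_over j delta.
Proof.
move=> Einj; pose i (x : E) : twist_graded j E := (0, x).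
have i_lin : linear i.
  by move=> a x y; congr pair; rewrite /= ?scaler0 ?addr0.
have [||||g [g_deg gK]] :=
  @extend_along A m E (twist_graded j E) E (to_linear i_lin) 0 id Einj.
- by move=> n x hx; split=> //; exact: gm_deg0.
- by [].
- by move=> n x hx; rewrite addr0.
- by move=> x [].
pose s (x : E) : twist_graded j E := (x, 0).
exists (fun x => - g (s x)); split.
- move=> x y; rewrite -opprD -linearD; congr (- g _).
  by congr pair; rewrite /= addr0.
- move=> r x.
  have -> : s (r *: x) = r *: s x - to_linear i_lin (r^`M(j) *: x).
    by congr pair; rewrite /= ?subr0 // scaler0 add0r subrr.
  by rewrite linearB linearZ gK opprB scalerN addrC.
move=> n x hx; apply: gm_degN; rewrite -[_ + _]addr0.
by apply: g_deg; split; rewrite /= ?subrK //; exact: gm_deg0.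
Qed.

(** Starting from an arbitrary derivation [eta] of [E], the defect
    [d delta - eta d] is linear because the two Leibniz corrections cancel; it
    extends along [d] to a linear map, which is added to [eta]. *)
Lemma derivation_along N E (j : 'I_m) (d : {linear N -> E}) (delta : N -> N) :
  graded_injective E -> graded_hom d -> derivation_over j delta ->
  (forall x, d x = 0 -> d (delta x) = 0) ->
  exists2 delta' : E -> E, derivation_over j delta' &
    forall x, delta' (d x) = d (delta x).
Proof.
move=> Einj hd [deltaD deltaZ delta_deg] dker.
have [eta eta_der] := injective_derivation j Einj.
have [etaD etaZ eta_deg] := eta_der.
have [|||h [h_deg hE]] :=
  @extend_along A m N E E d (-1) (fun x => d (delta x) - eta (d x)) Einj hd.
- move=> a x y; rewrite deltaD deltaZ !linearD !linearZ etaD etaZ /=.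
  rewrite scalerN opprD addrACA; congr (_ + _).
  by rewrite opprD addrACA subrr addr0.
- move=> n x hx; apply: gm_degB; first exact/hd/delta_deg.
  exact/eta_deg/hd.
- by move=> x dx; rewrite dker // dx (derivation0 eta_der) subrr.
exists (fun x => eta x + h x); last by move=> x; rewrite hE addrC subrK.
split=> [x y|r x|n x hx].
- by rewrite etaD linearD addrACA.
- by rewrite etaZ linearZ scalerDr addrAC.
by apply: gm_degD; [exact: eta_deg | exact: h_deg].
Qed.

End Derivation.

(** * Torsion elements *)

Section Torsion.
Context (A : comNzRingType) (m : nat).
Local Notation R := {mpoly A[m]}.
Context (I : R -> Prop).
Implicit Types M N : gradedModule A m.

(** The elements killed by the [k]-th power of [I].  Peeling off one factor at a
    time lets all stability properties go by induction on [k], without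
    expanding products of elements of [I]. *)
Fixpoint killed M (k : nat) (x : M) : Prop :=
  if k is k'.+1 then forall r, I r -> killed k' (r *: x) else x = 0.

Lemma killed_prod M k (x : M) :
  (forall t : seq R, size t = k -> (forall y, y \in t -> I y) ->
     (\prod_(y <- t) y) *: x = 0) <-> killed k x.
Proof.
elim: k x => [|k ih] x /=; split.
- by move=> /(_ [::] erefl) <- //; rewrite big_nil scale1r.
- by move=> -> t _ _; rewrite scaler0.
- move=> hx r Ir; apply/ih => t st It.
  rewrite scalerA mulrC -[_ * _](big_cons _ _ _ _ predT id).
  apply: hx; first by rewrite /= st.
  by move=> y; rewrite inE => /predU1P[->|/It].
move=> hx [//|r t] [st] It; rewrite big_cons mulrC -scalerA.
apply: (proj2 (ih _) (hx r _)) => // [|y ty]; apply: It; rewrite inE ?eqxx //.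
by rewrite ty orbT.
Qed.

Lemma ideal_pow_kills M k (x : M) :
  (forall r, ideal_pow I k r -> r *: x = 0) <-> killed k x.
Proof.
rewrite -killed_prod; split=> hx => [t st It|r [s [hs ->]]].
  apply: hx; exists [:: (1, \prod_(y <- t) y)]; split.
    move=> c; rewrite inE => /eqP-> /=.
    by exists (Tuple (introT eqP st)).
  by rewrite big_seq1 mul1r.
rewrite scaler_suml big_seq big1 // => c /hs[t [It ->]].
by rewrite -scalerA hx ?size_tuple // scaler0.
Qed.

Lemma GammaE M (x : M) : Gamma I x <-> exists k, killed k x.
Proof. by split=> -[k hk]; exists k; apply/ideal_pow_kills. Qed.

Lemma killed0 M k : killed k (0 : M).
Proof. by elim: k => //= k ih r _; rewrite scaler0. Qed.

Lemma killedD M k (x y : M) : killed k x -> killed k y -> killed k (x + y).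
Proof.
elim: k x y => /= [x y -> ->|k ih x y hx hy r Ir]; first by rewrite addr0.
by rewrite scalerDr; apply: ih; [exact: hx | exact: hy].
Qed.

Lemma killed_linear M N (f : {linear M -> N}) k x : killed k x -> killed k (f x).
Proof.
elim: k x => /= [x ->|k ih x hx r Ir]; first by rewrite linear0.
by rewrite -linearZ; apply/ih/hx.
Qed.

Lemma killedZ M k (a : R) (x : M) : killed k x -> killed k (a *: x).
Proof.
elim: k x => /= [x ->|k ih x hx r Ir]; first by rewrite scaler0.
by rewrite scalerA mulrC -scalerA; apply/ih/hx.
Qed.

Lemma killed_le M k l (x : M) : (k <= l)%N -> killed k x -> killed l x.
Proof.
elim: l k x => [|l ih] [|k] x //=.
  by move=> _ -> r _; rewrite scaler0; exact: killed0.
by move=> kl hx r Ir; apply/ih/hx.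
Qed.

(** One more factor is needed to absorb the derivative in
    [r *: delta x = delta (r *: x) - r^`M(j) *: x]. *)
Lemma killed_derivation (j : 'I_m) M (delta : M -> M) k x :
  derivation_over j delta -> killed k x -> killed k.+1 (delta x).
Proof.
move=> delta_der; elim: k x => [x -> r _|k ih x hx r Ir].
  by rewrite /= (derivation0 delta_der) scaler0.
change (killed k.+1 (r *: delta x)).
have -> : r *: delta x = delta (r *: x) + - r^`M(j) *: x.
  by rewrite (derivationZ delta_der) scaleNr addrK.
by apply: killedD; [exact/ih/hx | exact: killedZ].
Qed.

Lemma killed_component M k (x : M) n : is_homogeneous_ideal I ->
  killed k x -> killed k (component n x).
Proof.
move=> [I_ideal I_comp]; elim: k x n => [|k ih] x n /=.
  by move=> ->; rewrite component_homog //; exact: gm_deg0.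
move=> hx r Ir.
have -> : r = \sum_(d < msize r) pihomog mdeg d r.
  exact: (pihomog_partitionE (leqnn _)).
rewrite scaler_suml.
elim/big_ind: _ => [|y z|d _]; [exact: killed0|exact: killedD|].
have hd : has_degree d%:Z (fun y : M => pihomog mdeg d r *: y).
  by move=> l y hy; apply: gm_degZ => //; exact: pihomogP.
have <- := component_map (f := GRing.scale (pihomog mdeg d r)) hd n x.
exact/ih/hx/I_comp.
Qed.

Lemma Gamma0 M : Gamma I (0 : M).
Proof. by apply/GammaE; exists 0%N. Qed.

Lemma GammaD M (x y : M) : Gamma I x -> Gamma I y -> Gamma I (x + y).
Proof.
move=> /GammaE[k hk] /GammaE[l hl]; apply/GammaE; exists (maxn k l).
by apply: killedD; [apply: killed_le hk | apply: killed_le hl];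
  rewrite ?leq_maxl ?leq_maxr.
Qed.

Lemma GammaZ M a (x : M) : Gamma I x -> Gamma I (a *: x).
Proof. by move=> /GammaE[k hk]; apply/GammaE; exists k; exact: killedZ. Qed.

Lemma Gamma_linear M N (f : {linear M -> N}) x : Gamma I x -> Gamma I (f x).
Proof. by move=> /GammaE[k hk]; apply/GammaE; exists k; exact: killed_linear. Qed.

Lemma Gamma_derivation (j : 'I_m) M (delta : M -> M) x :
  derivation_over j delta -> Gamma I x -> Gamma I (delta x).
Proof.
move=> hdelta /GammaE[k hk]; apply/GammaE; exists k.+1.
exact: killed_derivation hdelta hk.
Qed.

Lemma Gamma_component M (x : M) n : is_homogeneous_ideal I ->
  Gamma I x -> Gamma I (component n x).
Proof.
by move=> Ih /GammaE[k hk]; apply/GammaE; exists k; exact: killed_component.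
Qed.

End Torsion.

(** * The Euler operator *)

Section Euler.
Context (A : comNzRingType) (m : nat).
Local Notation R := {mpoly A[m]}.
Implicit Types M N : gradedModule A m.

Definition euler M (delta : 'I_m -> M -> M) (x : M) : M :=
  \sum_(j < m) 'X_j *: delta j x.

Lemma euler_map M N (f : {linear M -> N})
    (delta : 'I_m -> M -> M) (delta' : 'I_m -> N -> N) :
  (forall j x, delta' j (f x) = f (delta j x)) ->
  forall x, euler delta' (f x) = f (euler delta x).
Proof.
move=> h x; rewrite /euler linear_sum; apply: eq_bigr => j _.
by rewrite linearZ h.
Qed.

(** Summed over [j], the commutation relation [D_j X_j = X_j D_j + 1] of the
    Weyl algebra. *)
Lemma euler_comm M (delta : 'I_m -> M -> M) x :
  (forall j, derivation_over j (delta j)) ->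
  \sum_(j < m) delta j ('X_j *: x) = euler delta x + x *+ m.
Proof.
move=> hd; have -> : x *+ m = \sum_(j < m) x by rewrite sumr_const card_ord.
rewrite /euler -big_split.
by apply: eq_bigr => j _; rewrite (derivationZ (hd j)) mderiv_X scale1r.
Qed.

Definition mpoly_partial (j : 'I_m) (x : mpoly_graded A m) : mpoly_graded A m :=
  mderiv j x.

Lemma mpoly_partial_derivation (j : 'I_m) : derivation_over j (mpoly_partial j).
Proof.
split=> [|r x|n x].
- by move=> x y; exact: mderivD.
- by rewrite [LHS]mderivM addrC.
case: n => [[|d]|d] hx.
- by rewrite /= /mpoly_partial mderiv_homog0.
- have e : d.+1%:Z + -1 = d by rewrite -addn1 PoszD addrK.
  change (mpoly_deg (d.+1%:Z + -1) (x^`M(j) : {mpoly A[m]}^o)).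
  by rewrite e /=; exact: mderiv_homog.
have -> : x = 0 by exact: hx.
by rewrite /mpoly_partial mderiv0; exact: (gm_deg0 (mpoly_graded A m)).
Qed.

Lemma mpoly_partial_euler x : euler mpoly_partial x = degree_op x.
Proof.
have euler0 : euler mpoly_partial 0 = 0.
  by rewrite /euler big1 // => j _; rewrite /mpoly_partial mderiv0 scaler0.
elim/graded_ind: x => [|x y hx hy|[d|d] x hx].
- by rewrite euler0 degree_op0.
- rewrite degree_opD -hx -hy /euler -big_split; apply: eq_bigr => j _.
  by rewrite /mpoly_partial mderivD scalerDr.
- by rewrite (degree_op_homog hx) -pmulrn; exact: mpoly_euler hx.
have -> : x = 0 by exact: hx.
by rewrite euler0 degree_op0.
Qed.

(** The degree operator is a derivation over the Euler derivation of [R]; this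
    is why subtracting it from [euler delta] leaves a linear map. *)
Lemma degree_opZ M (r : R) (x : M) :
  degree_op (r *: x) = r *: degree_op x + euler mpoly_partial r *: x.
Proof.
rewrite mpoly_partial_euler.
elim/(@graded_ind A m (mpoly_graded A m)): r => [|r s hr hs|[d|d] r hr].
- by rewrite !degree_op0 !scale0r degree_op0 addr0.
- by rewrite scalerDl !degree_opD hr hs !scalerDl addrACA.
- rewrite (degree_op_homog hr).
  elim/graded_ind: x => [|x y hx hy|n x hx].
  + by rewrite !(scaler0, degree_op0) addr0.
  + by rewrite scalerDr !degree_opD hx hy !scalerDr addrACA.
  rewrite (degree_op_homog hx) (degree_op_homog (gm_degZ hr hx)).
  by rewrite mulrzDr scalerMzr scalerMzl.
have -> : r = 0 by exact: hr.
by rewrite !degree_op0 !scale0r degree_op0 addr0.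
Qed.

Lemma euler_degree_linear M (delta : 'I_m -> M -> M) :
  (forall j, derivation_over j (delta j)) ->
  linear (fun x => euler delta x - degree_op x).
Proof.
move=> hd a x y.
have eulerD u v : euler delta (u + v) = euler delta u + euler delta v.
  rewrite /euler -big_split; apply: eq_bigr => j _.
  by rewrite (derivationD (hd j)) scalerDr.
have eulerZ u : euler delta (a *: u) =
    a *: euler delta u + euler mpoly_partial a *: u.
  rewrite /euler scaler_sumr scaler_suml -big_split; apply: eq_bigr => j _.
  by rewrite (derivationZ (hd j)) scalerDr !scalerA [a * _]mulrC.
rewrite eulerD degree_opD opprD addrACA; congr (_ + _).
by rewrite eulerZ degree_opZ opprD addrACA subrr addr0 scalerBr.
Qed.

Lemma euler_degree_deg M (delta : 'I_m -> M -> M) :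
  (forall j, derivation_over j (delta j)) ->
  has_degree 0 (fun x => euler delta x - degree_op x).
Proof.
move=> hd n x hx; rewrite addr0; apply: gm_degB.
  apply: gm_deg_sum => j; rewrite -[n](subrK 1); apply: gm_degZ.
    exact: mpolyX_homog.
  exact: derivation_deg (hd j) _ _ hx.
by rewrite (degree_op_homog hx); exact: gm_degMz.
Qed.

End Euler.

(** * Derivations of an injective resolution *)

Section Resolution.
Context (A : comNzRingType) (m : nat) (I : {mpoly A[m]} -> Prop).
Context (N : gradedModule A m) (E : injective_resolution N).
Context (partial : 'I_m -> N -> N).
Hypothesis partial_derivation : forall j, derivation_over j (partial j).
Hypothesis partial_euler : forall x, euler partial x = degree_op x.

(** The state of the induction along the resolution.  If [h] is the homotopy
    from 0 to the Euler operator minus the degree operator, then [g] is its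
    part [d h]; the part [h d] vanishes on cocycles.  Keeping [g] instead of
    [h] makes the first step uniform, with [g = 0]. *)
Record euler_homotopic k (delta : 'I_m -> ir_obj E k -> ir_obj E k)
    (g : {linear ir_obj E k -> ir_obj E k}) : Prop := EulerHomotopic {
  eh_derivation : forall j, derivation_over j (delta j);
  eh_cocycle : forall j x, ir_diff E k x = 0 -> ir_diff E k (delta j x) = 0;
  eh_coboundary : forall j x,
    Gamma_coboundary I x -> Gamma_coboundary I (delta j x);
  eh_deg : has_degree 0 g;
  eh_g_cocycle : forall x, ir_diff E k (g x) = 0;
  eh_g_coboundary : forall x, Gamma I x -> Gamma_coboundary I (g x);
  eh_euler : forall x, ir_diff E k x = 0 -> g x = euler delta x - degree_op x }.

Lemma zero_linear (U V : gradedModule A m) : linear (fun _ : U => 0 : V).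
Proof. by move=> a x y; rewrite scaler0 addr0. Qed.

Lemma euler_homotopic0 : exists delta g, @euler_homotopic 0 delta g.
Proof.
have aug_ker x : ir_aug E x = 0 -> x = 0.
  by move=> h; apply: (ir_aug_inj (i := E)); rewrite h linear0.
have /choice[delta hdelta] (j : 'I_m) : exists delta : ir_obj E 0 -> ir_obj E 0,
    derivation_over j delta /\
    forall x, delta (ir_aug E x) = ir_aug E (partial j x).
  have [||delta h1 h2] := derivation_along (d := ir_aug E)
     (@ir_injective _ _ _ E 0) _ (partial_derivation j).
  - exact: ir_aug_hom.
  - by move=> x /aug_ker ->; rewrite (derivation0 (partial_derivation j)) linear0.
  by exists delta.
exists delta, (to_linear (@zero_linear _ _)); split.
- by move=> j; case: (hdelta j).
- move=> j x /ir_exact0[y ->]; apply/ir_exact0; exists (partial j y).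
  by case: (hdelta j).
- by move=> j x /= ->; case: (hdelta j) => /derivation0.
- by move=> n x _; exact: gm_deg0.
- by move=> x; rewrite linear0.
- by [].
move=> x /ir_exact0[y ->].
rewrite (euler_map (delta := partial)); last by move=> j; case: (hdelta j).
rewrite partial_euler degree_op_map ?subrr //.
exact/graded_hom_degree/ir_aug_hom.
Qed.

Lemma euler_homotopicS k :
  (exists delta g, @euler_homotopic k delta g) ->
  exists delta g, @euler_homotopic k.+1 delta g.
Proof.
move=> [delta [g [delta_der delta_cyc delta_cob g_deg g_cyc g_cob g_euler]]].
have /choice[delta' hdelta'] (j : 'I_m) :
    exists delta' : ir_obj E k.+1 -> ir_obj E k.+1, derivation_over j delta' /\
      forall x, delta' (ir_diff E k x) = ir_diff E k (delta j x).
  have [||delta' h1 h2] := derivation_along (d := ir_diff E k)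
     (@ir_injective _ _ _ E k.+1) _ (delta_der j).
  - exact: ir_diff_hom.
  - exact: delta_cyc.
  by exists delta'.
(* The next piece of the homotopy is an extension of [phi] along [d]. *)
pose phi x := euler delta x - degree_op x - g x.
have phi_lin : linear phi.
  move=> a x y; rewrite /phi (euler_degree_linear delta_der) linearP opprD.
  by rewrite addrACA -!scalerBr.
have [||h [h_deg hE]] := extend_along (d := ir_diff E k) (e := 0)
    (@ir_injective _ _ _ E k) (@ir_diff_hom _ _ _ E k) phi_lin.
- move=> n x hx; apply: gm_degB; last exact: g_deg.
  exact: (euler_degree_deg delta_der).
- by move=> x dx; rewrite /phi g_euler // subrr.
have g'_lin : linear (fun x => ir_diff E k (h x)).
  by move=> a x y; rewrite !linearP.
exists delta', (to_linear g'_lin); split.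
- by move=> j; case: (hdelta' j).
- move=> j x /ir_exactS[y ->]; apply/ir_exactS; exists (delta j y).
  by case: (hdelta' j).
- move=> j _ [y [Gy ->]]; exists (delta j y); split; last by case: (hdelta' j).
  exact: Gamma_derivation (delta_der j) Gy.
- move=> n x hx /=; rewrite addr0; apply: ir_diff_hom; rewrite -[n]addr0.
  exact: h_deg.
- by move=> x; apply/ir_exactS; exists (h x).
- by move=> x Gx; exists (h x); split=> //; exact: Gamma_linear.
move=> x /ir_exactS[y ->] /=.
rewrite (euler_map (delta := delta)); last by move=> j; case: (hdelta' j).
rewrite degree_op_map; last exact/graded_hom_degree/ir_diff_hom.
by rewrite -linearB hE [LHS]linearB g_cyc subr0.
Qed.

Lemma euler_homotopic_exists k : exists delta g, @euler_homotopic k delta g.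
Proof.
by elim: k => [|k]; [exact: euler_homotopic0 | exact: euler_homotopicS].
Qed.

End Resolution.

(** * Local cohomology as a quotient of torsion cocycles *)

Section Presentation.
Context (A : comNzRingType) (m : nat) (I : {mpoly A[m]} -> Prop).
Context (N M : gradedModule A m) (E : injective_resolution N) (i : nat).
Local Notation cocycle := (@Gamma_cocycle A m I N E i).

Lemma cocycleP r x y : cocycle x -> cocycle y -> cocycle (r *: x + y).
Proof.
move=> [Gx dx] [Gy dy]; split; first exact/GammaD/Gy/GammaZ.
by rewrite linearP dx dy scaler0 addr0.
Qed.

Lemma cocycle0 : cocycle 0.
Proof. by split; [exact: Gamma0 | exact: linear0]. Qed.

Lemma cocycleZ r x : cocycle x -> cocycle (r *: x).
Proof.
by move=> cx; rewrite -[r *: x]addr0; apply: cocycleP => //; exact: cocycle0.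
Qed.

Lemma cocycle_sum (J : Type) (s : seq J) (F : J -> ir_obj E i) :
  (forall j, cocycle (F j)) -> cocycle (\sum_(j <- s) F j).
Proof.
move=> cF; elim/big_ind: _ => // [|x y cx cy]; first exact: cocycle0.
by rewrite -[x]scale1r; exact: cocycleP.
Qed.

Lemma cocycle_component n x :
  is_homogeneous_ideal I -> cocycle x -> cocycle (component n x).
Proof.
move=> Ih [Gx dx]; split; first exact: Gamma_component.
have := component_map (graded_hom_degree (@ir_diff_hom _ _ _ E i)) n x.
by move=> /= <-; rewrite dx component_homog //; exact: gm_deg0.
Qed.

Context (q : ir_obj E i -> M).
Hypothesis q_lin : forall r x y, cocycle x -> cocycle y ->
  q (r *: x + y) = r *: q x + q y.
Hypothesis q_surj : forall z, exists x, cocycle x /\ q x = z.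
Hypothesis q_ker : forall x, cocycle x -> (q x = 0 <-> Gamma_coboundary I x).
Hypothesis q_deg : forall n x, cocycle x -> gm_deg n x -> gm_deg n (q x).

Lemma class0 : q 0 = 0.
Proof.
apply/q_ker; first exact: cocycle0.
by case: (i) => [|k] //=; exists 0; split; [exact: Gamma0 | rewrite linear0].
Qed.

Lemma classZ r x : cocycle x -> q (r *: x) = r *: q x.
Proof.
move=> cx; rewrite -[r *: x]addr0 q_lin ?class0 ?addr0 //.
exact: cocycle0.
Qed.

Lemma class_sum (J : Type) (s : seq J) (F : J -> ir_obj E i) :
  (forall j, cocycle (F j)) -> q (\sum_(j <- s) F j) = \sum_(j <- s) q (F j).
Proof.
move=> cF; elim: s => [|j s ih]; first by rewrite !big_nil class0.
rewrite !big_cons -[F j in LHS]scale1r q_lin ?scale1r ?ih //.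
exact: cocycle_sum.
Qed.

Lemma homogeneous_representative n (z : M) : is_homogeneous_ideal I ->
  gm_deg n z -> exists x, [/\ cocycle x, gm_deg n x & q x = z].
Proof.
move=> Ih hz; have [y [cy qy]] := q_surj z.
have cc k : cocycle (component k y) by exact: cocycle_component.
exists (component n y); split=> //; first exact: component_deg.
have [uy hy y0 yE] := componentP y.
have := @component_uniq A m M z (degrees y) (fun k => q (component k y)) uy.
move=> /(_ _ _ n); rewrite (component_homog hz) => ->.
- by case: ifPn => // /y0 ->; exact: class0.
- by move=> k; exact: q_deg.
by rewrite -qy {1}yE class_sum.
Qed.

End Presentation.

Section LocalCohomology.
Context (A : comNzRingType) (m : nat) (I : {mpoly A[m]} -> Prop).
Hypothesis I_homog : is_homogeneous_ideal I.
Context (N M : gradedModule A m) (i : nat) (M_lc : is_local_cohomology I i N M).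
Context (partial : 'I_m -> N -> N).
Hypothesis partial_derivation : forall j, derivation_over j (partial j).
Hypothesis partial_euler : forall x, euler partial x = degree_op x.

(** Local cohomology inherits from [N] the Weyl algebra relations
    [\sum_j X_j D_j = n] and [\sum_j D_j X_j = n + m] in degree [n].  They are
    stated through what they imply for a single element, so that the induced
    operators need not be defined on the quotient [M]. *)
Lemma local_cohomology_euler n (z : M) : gm_deg n z ->
  (exists2 w : 'I_m -> M, forall j, gm_deg (n - 1) (w j) &
     z *~ n = \sum_(j < m) 'X_j *: w j) /\
  ((forall j : 'I_m, 'X_j *: z = 0) -> z *~ (n + m%:Z) = 0).
Proof.
case: M_lc => E [q [q_lin q_surj q_ker q_deg]] hz.
have [delta [g [der cyc cob g_deg g_cyc g_cob g_euler]]] :=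
  euler_homotopic_exists I E partial_derivation partial_euler i.
have [x [cx hx qx]] :=
  homogeneous_representative q_lin q_surj q_ker q_deg I_homog hz.
have coc_delta j y : Gamma_cocycle I y -> Gamma_cocycle I (delta j y).
  by move=> [Gy dy]; split; [exact: Gamma_derivation (der j) Gy | exact: cyc].
have coc_Xdelta j : Gamma_cocycle I ('X_j *: delta j x).
  exact/cocycleZ/coc_delta.
have coc_deltaX j : Gamma_cocycle I (delta j ('X_j *: x)).
  exact/coc_delta/cocycleZ.
have q_euler : q (euler delta x) = z *~ n.
  have [Gx dx] := cx.
  have -> : euler delta x = n%:~R *: x + g x.
    by rewrite g_euler // (degree_op_homog hx) scaler_int addrC subrK.
  have cg : Gamma_cocycle I (g x) by split; [exact: Gamma_linear | exact: g_cyc].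
  rewrite q_lin // qx scaler_int (_ : q (g x) = 0) ?addr0 //.
  exact/q_ker/g_cob.
split=> [|Xz0].
  exists (fun j => q (delta j x)) => [j|].
    apply: q_deg; first exact: coc_delta.
    exact: derivation_deg (der j) _ _ hx.
  rewrite -q_euler (class_sum q_lin q_ker) //; apply: eq_bigr => j _.
  by rewrite (classZ q_lin q_ker) //; exact: coc_delta.
have qX j : q ('X_j *: x) = 0 by rewrite (classZ q_lin q_ker) // qx Xz0.
have : q (\sum_(j < m) delta j ('X_j *: x)) = 0.
  rewrite (class_sum q_lin q_ker) // big1 // => j _; apply/q_ker => //.
  by apply/cob/q_ker => //; exact: cocycleZ.
rewrite euler_comm // -scaler_nat addrC q_lin //; last exact: cocycle_sum.
by rewrite q_euler qx scaler_nat mulrzDr -pmulrn addrC.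
Qed.

End LocalCohomology.

(** * Propagation of nonvanishing *)

Lemma intr_torsion_free (A : comNzRingType) (m : nat) (U : lmodType {mpoly A[m]})
    (z : U) (n : int) :
  contains_field_char0 A -> n != 0 -> z *~ n = 0 -> z = 0.
Proof.
move=> [k [k0 [f]]] n0.
have nk : n%:~R != 0 :> k.
  have k0' := proj1 (pcharf0P k) k0.
  by case: n n0 => d d0; rewrite ?NegzE ?mulrNz ?oppr_eq0 -pmulrn k0'.
rewrite -scaler_int => h.
have e : (f (n%:~R)^-1)%:MP * (n%:~R : {mpoly A[m]}) = 1.
  rewrite -(rmorph_int (@mpolyC m A)) -(rmorph_int f) -mpolyCM -rmorphM.
  by rewrite mulVf // rmorph1.
by rewrite -[z]scale1r -e -scalerA h scaler0.
Qed.

Lemma component_neq0_step (A : comNzRingType) (m : nat)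
    (I : {mpoly A[m]} -> Prop) (i : nat) (M : gradedModule A m) (n : int) :
  contains_field_char0 A -> is_homogeneous_ideal I ->
  is_local_cohomology I i (mpoly_graded A m) M -> component_neq0 M n ->
  (n != 0 -> component_neq0 M (n - 1)) /\
  (n != - m%:Z -> component_neq0 M (n + 1)).
Proof.
move=> A_char0 I_homog M_lc [z [hz z0]].
have [[w hw zw] zX] := local_cohomology_euler I_homog M_lc
  (@mpoly_partial_derivation A m) (@mpoly_partial_euler A m) hz.
split=> n0; apply: contrapT => M0; apply: z0.
  apply: intr_torsion_free A_char0 n0 _; rewrite zw big1 // => j _.
  rewrite [w j](_ : _ = 0) ?scaler0 //.
  by apply: contrapT => wj; apply: M0; exists (w j).
apply: (@intr_torsion_free _ _ _ _ (n + m%:Z)); rewrite ?addr_eq0 //.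
apply: zX => j; apply: contrapT => Xz; apply: M0; exists ('X_j *: z).
by split=> //; apply: gm_degZ => //; exact: mpolyX_homog.
Qed.

Theorem theorem1p6 (A : comNzRingType) (m : nat) (I : {mpoly A[m]} -> Prop)
    (i : nat) (M : gradedModule A m)
    (A_regular : regular_ring A) (A_char0 : contains_field_char0 A)
    (m_gt0 : (0 < m)%N) (I_homog : is_homogeneous_ideal I)
    (M_lc : is_local_cohomology I i (mpoly_graded A m) M) :
  [/\ (exists r : int, r <= - m%:Z /\ component_neq0 M r) <->
      (forall n : int, n <= - m%:Z -> component_neq0 M n),
      (exists s : int, 0 <= s /\ component_neq0 M s) <->
      (forall n : int, 0 <= n -> component_neq0 M n) &
      (2 <= m)%N ->
        ((exists t : int, (- m%:Z < t /\ t < 0) /\ component_neq0 M t) <->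
         (forall n : int, component_neq0 M n))].
Proof.
have step n := @component_neq0_step A m I i M n A_char0 I_homog M_lc.
have climb (a b : int) : a <= b -> (forall k : int, a <= k -> k < b -> k != - m%:Z) ->
    component_neq0 M a -> component_neq0 M b.
  move=> ab kP Ma; suff H (d : nat) : a + d%:Z <= b -> component_neq0 M (a + d%:Z).
    have -> : b = a + `|b - a|%N%:Z by lia.
    by apply: H; lia.
  elim: d => [|d ih] hd; first by rewrite addr0.
  have -> : a + d.+1%:Z = a + d%:Z + 1 by lia.
  by apply: (step _ (ih _)).2; [lia | apply: kP; lia].
have descend (a b : int) : b <= a -> (forall k : int, b < k -> k <= a -> k != 0) ->
    component_neq0 M a -> component_neq0 M b.
  move=> ba kP Ma; suff H (d : nat) : b <= a - d%:Z -> component_neq0 M (a - d%:Z).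
    have -> : b = a - `|a - b|%N%:Z by lia.
    by apply: H; lia.
  elim: d => [|d ih] hd; first by rewrite subr0.
  have -> : a - d.+1%:Z = a - d%:Z - 1 by lia.
  by apply: (step _ (ih _)).1; [lia | apply: kP; lia].
split.
- split=> [[r [hr Mr]] n hn|hM]; last by exists (- m%:Z); split=> //; exact: hM.
  have [rn|nr] := leP r n.
    by apply: climb Mr => // k; lia.
  by apply: descend Mr => [|k]; lia.
- split=> [[s [hs Ms]] n hn|hM]; last by exists 0; split=> //; exact: hM.
  have [sn|ns] := leP s n.
    by apply: climb Ms => // k; lia.
  by apply: descend Ms => [|k]; lia.
move=> m_ge2; split=> [[t [[mt t0] Mt]] n|hM]; last first.
  by exists (-1); split; [lia | exact: hM].
have [tn|nt] := leP t n.
  by apply: climb Mt => // k; lia.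
by apply: descend Mt => [|k]; lia.
Qed.
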